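(* Let $\mathcal{F}$ be a reproducing kernel Hilbert space of real-valued functions on an input space $\mathcal{X}$, with norm $\|\cdot\|$, and assume that $\mathcal{F}$ admits the orthogonal decomposition $$\mathcal{F}=\{1\}\oplus\mathcal{F}_1,\qquad \mathcal{F}_1=\bigoplus_{\alpha=1}^{p}\mathcal{F}^{\alpha},$$ where $\{1\}$ denotes the space of constant functions and $\mathcal{F}^1,\dots,\mathcal{F}^p$ are orthogonal (closed) subspaces of $\mathcal{F}$. Let $P^{\alpha}$ denote the orthogonal projection of $\mathcal{F}$ onto $\mathcal{F}^{\alpha}$. Let $n\ge 1$, $x_1,\dots,x_n\in\mathcal{X}$, $y_1,\dots,y_n\in\mathbb{R}$ and $\tau>0$. Then there exists $\hat f\in\mathcal{F}$ that minimizes, over all $f\in\mathcal{F}$, the functional $$\frac1n\sum_{i=1}^{n}\{y_i-f(x_i)\}^2+\tau^2\sum_{\alpha=1}^{p}\|P^{\alpha}f\|.$$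
   Context: The functional is the COSSO objective; note that its penalty is a sum of (unsquared) RKHS norms of the components, and that the constant component of $f$ is not penalized. *)

(* Defs.v *)
From HB Require Import structures.
From mathcomp Require Import all_boot all_order all_algebra.
From mathcomp Require Import sesquilinear.
From mathcomp Require Import boolp classical_sets functions reals topology
  normedtype.

Set Implicit Arguments.
Unset Strict Implicit.
Unset Printing Implicit Defensive.

Import Order.TTheory GRing.Theory Num.Theory.
Import numFieldNormedType.Exports.

Local Open Scope classical_set_scope.
Local Open Scope ring_scope.

HB.mixin Record isHilbert (R : realType) F & CompleteNormedModule R F := {
  inner : {dot F for idfun} ;
  sqr_normE : forall f : F, `|f| ^+ 2 = inner f f
}.

#[short(type="hilbertType")]
HB.structure Definition Hilbert (R : realType) :=
  {F of isHilbert R F & CompleteNormedModule R F}.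

(* The elements of a space of functions X -> R are points of an abstract Hilbert
   space; [eval f] is the function that f stands for, and [eval_inj] says that
   f is determined by it. *)
HB.mixin Record isRKHS (R : realType) (X : Type) F & Hilbert R F := {
  eval : F -> X -> R ;
  eval_inj : injective eval ;
  eval_scalar : forall x, scalar (eval^~ x) ;
  eval_continuous : forall x, continuous (eval^~ x)
}.

#[short(type="rkhsType")]
HB.structure Definition RKHS (R : realType) (X : Type) :=
  {F of isRKHS R X F & Hilbert R F}.

Section hilbert.
Context {R : realType} {F : hilbertType R}.
Implicit Types (A B : set F) (f g : F).

Definition closed_subspace A := submod_closed (mem A) /\ closed A.

Definition orthogonal_sets A B := forall f g, A f -> B g -> inner f g = 0.

Definition sum_sets (p : nat) (A : 'I_p -> set F) : set F :=
  [set f | exists g : 'I_p -> F,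
     (forall a, A a (g a)) /\ f = \sum_(a < p) g a].

(* Junk value 0 when f has no orthogonal projection on A, which does not happen
   for closed subspaces. *)
Definition orth_proj A f : F :=
  xget 0 [set g | A g /\ forall h, A h -> inner (f - g) h = 0].

End hilbert.

Section rkhs.
Context {R : realType} {X : Type} {F : rkhsType R X}.

Definition constants : set F := [set f | exists c : R, eval f = cst c].

(* F = {1} (+) F1 and F1 = (+)_(a < p) Fa a, all sums being orthogonal; the first
   condition says that the constant functions do belong to F. *)
Definition orthogonal_decomposition (p : nat) (Fa : 'I_p -> set F) :=
  let F1 := sum_sets Fa in
  [/\ exists one : F, eval one = cst 1,
      forall a, closed_subspace (Fa a),
      forall a b, a != b -> orthogonal_sets (Fa a) (Fa b),
      orthogonal_sets constants F1
    & forall f : F, exists c g, [/\ constants c, F1 g & f = c + g]].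

Definition cosso (p n : nat) (Fa : 'I_p -> set F) (x : 'I_n -> X)
    (y : 'I_n -> R) (tau : R) (f : F) : R :=
  n%:R^-1 * \sum_(i < n) (y i - eval f (x i)) ^+ 2
  + tau ^+ 2 * \sum_(a < p) `|orth_proj (Fa a) f|.

End rkhs.

(* Main.v *)
From Pilot Require Import Defs.
From HB Require Import structures.
From mathcomp Require Import all_boot all_order all_algebra.
From mathcomp Require Import sesquilinear ring lra.
From mathcomp Require Import boolp classical_sets functions reals
  interval_inference topology normedtype.

(** The objective [J] is convex, continuous and nonnegative, so what is needed
for a minimizer is a substitute for compactness of balls.  Completeness alone
gives one.  Let [m] be the infimum of [J].  Among the points where [J] is
close to [m], take those whose norm is almost as small as it can be there.
The midpoint of two such points is still almost minimal for [J], hence not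
much shorter than they are, and the parallelogram identity then forces the two
points to be close to each other.  So such points form a Cauchy sequence, and
by continuity [J] equals [m] at its limit.  This is
[midpoint_quasiconvex_attains_min]; it asks that a bound on [J] bound the norm.

For the COSSO objective, the decomposition of the space shows that every
orthogonal projection exists; the projections are then linear and do not
increase norms, which gives continuity ([cosso_continuous]) and convexity
([cosso_midpoint]).  The delicate hypothesis is the bound on sublevel sets
([cosso_coercive]), because the constant component [c] of [f = c + h] is not
penalized.  The penalty bounds the norm of [h], hence also the value of [h] at a
sample point, evaluation being bounded; the squared error bounds the value of
[f] at that same point; so [c] is bounded by the difference.  This is where at
least one observation and a positive [tau] are needed. *)

Set Implicit Arguments.
Unset Strict Implicit.
Unset Printing Implicit Defensive.

Import Order.TTheory GRing.Theory Num.Theory.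
Import numFieldNormedType.Exports.

Local Open Scope classical_set_scope.
Local Open Scope ring_scope.

(** * Minimization by the parallelogram identity *)

Section minimization.
Context {R : realType} {F : hilbertType R}.
Implicit Types (f g : F) (J : F -> R).

Lemma parallelogram f g :
  `|f - g| ^+ 2
  = 2 * `|f| ^+ 2 + 2 * `|g| ^+ 2 - 4 * `|2^-1 *: (f + g)| ^+ 2.
Proof.
rewrite normrZ exprMn !sqr_normE hnormB hnormD /= expr0 !mul1r.
by rewrite ger0_norm ?invr_ge0//; field.
Qed.

(** The threshold [d] is the limit, as [e] decreases to 0, of the infimum of
the squared norm over the sublevel set [J < m + e].  Those infima increase as
[e] decreases, so [d] is their supremum: nearly minimal points have squared
norm almost at least [d], and some of them have squared norm almost at most
[d]. *)
Lemma sublevel_norm_threshold J (m B : R) :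
    (forall e, 0 < e -> exists f, J f < m + e) ->
    (forall f, J f < m + 1 -> `|f| <= B) ->
  exists d : R,
    (forall h, 0 < h -> exists2 e, 0 < e &
       forall f, J f < m + e -> d - h < `|f| ^+ 2) /\
    (forall e, 0 < e -> exists f, J f < m + e /\ `|f| ^+ 2 < d + e).
Proof.
move=> Jm JB.
(* One supremum over all lower bounds on all sublevel sets stands for the
   supremum of the infima. *)
pose E := [set r : R | exists2 e, 0 < e &
  forall f, J f < m + e -> r <= `|f| ^+ 2].
have E0 : E 0 by exists 1 => // f _; exact: sqr_ge0.
have EB : ubound E (B ^+ 2).
  move=> r [e e0 re].
  have e1 : 0 < Num.min e 1 by rewrite lt_min e0 ltr01.
  have [f] := Jm _ e1.
  rewrite -ltrBlDl lt_min !ltrBlDl => /andP[Je J1].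
  apply: (le_trans (re f Je)); rewrite lerXn2r ?nnegrE//; last exact: JB.
  exact: le_trans (JB f J1).
have supE : has_sup E by split; [exists 0 | exists (B ^+ 2)].
exists (sup E); split=> [h h0|e e0].
  have [r [e e0 re] dr] := sup_adherent h0 supE.
  by exists e => // f /re; exact: lt_le_trans.
apply: contrapT => nf.
suff: E (sup E + e) by move/(ub_le_sup supE.2); rewrite gerDl leNgt e0.
exists e => // f Jf; rewrite leNgt; apply/negP => fd.
by apply: nf; exists f.
Qed.

(** Convexity serves only to keep the midpoint of two nearly minimal points
nearly minimal, hence its weak form with a maximum. *)
Theorem midpoint_quasiconvex_attains_min J :
    continuous J ->
    (forall f g, J (2^-1 *: (f + g)) <= Num.max (J f) (J g)) ->
    has_lbound (range J) ->
    (forall M, exists B, forall f, J f <= M -> `|f| <= B) ->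
  exists fhat, forall f, J fhat <= J f.
Proof.
move=> Jc Jmid Jlb Jco; pose m := inf (range J).
have mJ f : m <= J f by apply: ge_inf => //; exists f.
have Jm e : 0 < e -> exists f, J f < m + e.
  have Jinf : has_inf (range J) by split=> //; exists (J 0), 0.
  by move=> e0; have [_ [f _ <-] Jf] := inf_adherent e0 Jinf; exists f.
have [B JB] := Jco (m + 1).
have [d [dlow dup]] := sublevel_norm_threshold Jm (fun f Jf => JB f (ltW Jf)).
have invS_gt0 k : 0 < k.+1%:R^-1 :> R by rewrite invr_gt0.
have [u uP] := choice (fun k => dup _ (invS_gt0 k)).
have uc : cvg (u @ \oo).
  apply/cauchy_cvgP/cauchy_ballP => _/posnumP[e].
  (* The parallelogram identity leaves 2(d + h) + 2(d + h) - 4(d - h) = 8h, so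
     h is one eighth of the square of the distance to be reached. *)
  have h0 : 0 < e%:num ^+ 2 / 8 by [].
  have [e' e'0 dlow'] := dlow _ h0.
  have c0 : 0 < Num.min e' (e%:num ^+ 2 / 8) by rewrite lt_min e'0.
  have N := near_infty_natSinv_lt (PosNum c0).
  exists ([set u k | k in [set k | k.+1%:R^-1 < Num.min e' (e%:num ^+ 2 / 8)]],
          [set u k | k in [set k | k.+1%:R^-1 < Num.min e' (e%:num ^+ 2 / 8)]]).
    by split; apply: filterS N => k /= Nk; exists k.
  move=> [_ _] [/= [k]] + <- [l] + <-; rewrite /= !lt_min.
  move=> /andP[ke kh] /andP[le lh]; have [Jk dk] := uP k; have [Jl dl] := uP l.
  rewrite -ball_normE /= -(@ltr_pXn2r _ 2) ?nnegrE// parallelogram.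
  have : d - e%:num ^+ 2 / 8 < `|2^-1 *: (u k + u l)| ^+ 2.
    apply: dlow'; apply: le_lt_trans (Jmid _ _) _; rewrite gt_max.
    by rewrite (lt_trans Jk) ?(lt_trans Jl) ?ltrD2l.
  have dk' : `|u k| ^+ 2 < d + e%:num ^+ 2 / 8 by rewrite (lt_trans dk) ?ltrD2l.
  have dl' : `|u l| ^+ 2 < d + e%:num ^+ 2 / 8 by rewrite (lt_trans dl) ?ltrD2l.
  lra.
have uJ : J (u k) @[k --> \oo] --> J (lim (u @ \oo)).
  exact: continuous_cvg (Jc _) uc.
exists (lim (u @ \oo)) => f; apply: le_trans (mJ f).
apply/ler_addgt0Pr => e e0; apply: (cvgr_to_le uJ).
apply: filterS (near_infty_natSinv_lt (PosNum e0)) => k /= ke.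
have [Jk _] := uP k.
by apply/ltW/(lt_le_trans Jk); rewrite lerD // ltW.
Qed.

End minimization.

(** * Orthogonal projections *)

Section projection.
Context {R : realType} {F : hilbertType R}.
Implicit Types (A : set F) (f g h : F).

(** The condition that [orth_proj] selects by choice, as a relation, so that
existence and uniqueness can be treated apart. *)
Definition is_orth_proj A f g := A g /\ forall h, A h -> inner (f - g) h = 0.

Lemma submodP A : submod_closed (mem A) ->
  A 0 /\ forall (c : R) f g, A f -> A g -> A (c *: f + g).
Proof.
move=> [A0 AD]; split; first by move: A0; rewrite inE.
by move=> c f g Af Ag; have := AD c f g; rewrite !inE; apply.
Qed.

(** Two projections of [f] differ by a vector of [A] that is orthogonal to [A],
hence to itself. *)
Lemma orth_projE A f g : submod_closed (mem A) -> is_orth_proj A f g ->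
  orth_proj A f = g.
Proof.
move=> /submodP[A0 AD] [Ag fg]; apply: xget_unique => // g' [Ag' fg'].
have Agg : A (g' - g) by rewrite addrC -scaleN1r; exact: AD.
apply/eqP; rewrite -subr_eq0 -normr_eq0 -sqrf_eq0 sqr_normE.
rewrite [X in inner X](_ : _ = (f - g) - (f - g')).
  by rewrite linearBl /= fg // fg' // subrr.
by rewrite opprB [RHS]addrC addrA subrK.
Qed.

Section complemented.
Context (A : set F) (Asub : submod_closed (mem A)).
Context (Aproj : forall f, exists g, is_orth_proj A f g).

Lemma orth_projP f : is_orth_proj A f (orth_proj A f).
Proof. by have [g fg] := Aproj f; rewrite (orth_projE Asub fg). Qed.

Lemma orth_proj_linear : linear (orth_proj A).
Proof.
move=> c f g; apply: orth_projE => //.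
have [_ AD] := submodP Asub.
have [Af fP] := orth_projP f; have [Ag gP] := orth_projP g.
split=> [|h Ah]; first exact: AD.
rewrite opprD addrACA -scalerBr linearDl /= linearZl_LR /=.
by rewrite fP // gP // mulr0 addr0.
Qed.

(** Pythagoras for [f = (f - P f) + P f]. *)
Lemma norm_orth_proj_le f : `|orth_proj A f| <= `|f|.
Proof.
have [Af fP] := orth_projP f.
rewrite -(@ler_pXn2r _ 2) ?nnegrE// !sqr_normE.
have /hnormDd := fP _ Af.
rewrite subrK => ->; rewrite lerDr.
by have := sqr_ge0 `|f - orth_proj A f|; rewrite sqr_normE.
Qed.

Lemma orth_projD f g : orth_proj A (f + g) = orth_proj A f + orth_proj A g.
Proof. by have := orth_proj_linear 1 f g; rewrite !scale1r. Qed.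

Lemma orth_projZ c f : orth_proj A (c *: f) = c *: orth_proj A f.
Proof.
have P0 : orth_proj A 0 = 0.
  by apply/eqP; rewrite -normr_le0 -(normr0 F) norm_orth_proj_le.
by have := orth_proj_linear c f 0; rewrite !addr0 P0 addr0.
Qed.

(** By linearity and the previous bound, the norm of the projection is
1-Lipschitz. *)
Lemma norm_orth_proj_continuous : continuous (fun f => `|orth_proj A f| : R).
Proof.
move=> f; apply/cvgrPdist_le => e e0.
near=> g.
apply: le_trans (ler_dist_dist _ _) _.
rewrite -scaleN1r -orth_projZ -orth_projD scaleN1r.
apply: le_trans (norm_orth_proj_le _) _.
by near: g; exact: cvgr_dist_le.
Unshelve. all: by end_near. Qed.

End complemented.
End projection.

(** * Point evaluations *)

Section evaluation.
Context {R : realType} {X : Type} {F : rkhsType R X}.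
Implicit Types (f g : F) (x : X).

Lemma evalD x f g : Defs.eval (f + g) x = Defs.eval f x + Defs.eval g x.
Proof. by have := eval_scalar x 1 f g; rewrite scale1r mul1r. Qed.

Lemma eval0 x : Defs.eval (0 : F) x = 0.
Proof. by have /eqP := evalD x 0 0; rewrite addr0 -subr_eq subrr => /eqP. Qed.

Lemma evalZ x c f : Defs.eval (c *: f) x = c * Defs.eval f x.
Proof. by have := eval_scalar x c f 0; rewrite !addr0 eval0 addr0. Qed.

(** [R^o] is [R] as a normed module over itself, the codomain for which
continuous linear maps are known to be bounded. *)
Lemma eval_bounded x :
  exists2 K : R, 0 < K & forall f, `|Defs.eval f x| <= K * `|f|.
Proof.
pose L := GRing.isLinear.Build R F R^o *:%R (Defs.eval^~ x) (eval_scalar x).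
pose ev : {linear F -> R^o} := HB.pack (Defs.eval^~ x : F -> R^o) L.
have /linear_bounded_continuous/linear_boundedP/pinfty_ex_gt0 [K K0 KP] :
  continuous ev by exact: Defs.eval_continuous.
by exists K.
Qed.

End evaluation.

(** * The COSSO objective *)

Section objective.
Context {R : realType} {X : Type} {F : rkhsType R X}.
Context (p : nat) (Fa : 'I_p -> set F).
Context (dec : orthogonal_decomposition Fa).
Implicit Types (f g c : F).

Lemma summand_submod a : submod_closed (mem (Fa a)).
Proof. by have [_ /(_ a) []] := dec. Qed.

Lemma summand_sum_sets a f : Fa a f -> sum_sets Fa f.
Proof.
move=> Ff; exists (fun b => if b == a then f else 0); split=> [b|].
  case: eqP => [->//|_]; exact: (submodP (summand_submod b)).1.
by rewrite -big_mkcond big_pred1_eq.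
Qed.

(** The other components, the constant one included, are orthogonal to
[Fa a]. *)
Lemma decomposition_orth_proj c (g : 'I_p -> F) :
    constants c -> (forall b, Fa b (g b)) ->
  forall a, is_orth_proj (Fa a) (c + \sum_b g b) (g a).
Proof.
move=> cc gF a; split=> // h Fh; have [_ _ Forth corth _] := dec.
rewrite (bigD1 a) //= addrCA [X in X - _]addrC addrK linearDl /=.
rewrite corth ?add0r //; last exact: summand_sum_sets Fh.
rewrite linear_sumlz big1 // => b ba; exact: Forth (gF b) Fh.
Qed.

Lemma orth_proj_sum f :
  exists2 c, constants c & f = c + \sum_a orth_proj (Fa a) f.
Proof.
have [_ _ _ _ /(_ f) [c [_ [cc [g [gF ->]] ->]]]] := dec.
exists c => //; congr (_ + _); apply: eq_bigr => a _.
by rewrite (orth_projE (summand_submod a) (decomposition_orth_proj cc gF a)).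
Qed.

Lemma summand_proj a f : exists g, is_orth_proj (Fa a) f g.
Proof.
have [_ _ _ _ /(_ f) [c [_ [cc [g [gF ->]] ->]]]] := dec.
by exists (g a); exact: decomposition_orth_proj.
Qed.

Context (n : nat) (x : 'I_n -> X) (y : 'I_n -> R) (tau : R).
Local Notation J := (cosso Fa x y tau).

Lemma risk_ge0 f : 0 <= n%:R^-1 * \sum_(i < n) (y i - Defs.eval f (x i)) ^+ 2.
Proof. by rewrite mulr_ge0 ?invr_ge0// sumr_ge0 // => i _; exact: sqr_ge0. Qed.

Lemma penalty_ge0 f : 0 <= tau ^+ 2 * \sum_(a < p) `|orth_proj (Fa a) f|.
Proof. by rewrite mulr_ge0 ?sqr_ge0// sumr_ge0. Qed.

Lemma cosso_continuous : continuous J.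
Proof.
move=> f; apply: cvgD; apply: cvgMl_tmp.
  apply: cvg_big => [|i _]; first exact: add_continuous.
  by rewrite expr2; apply: cvgM; apply: cvgB (cvg_cst _) _;
    exact: Defs.eval_continuous.
apply: cvg_big => [|a _]; first exact: add_continuous.
exact: norm_orth_proj_continuous (summand_submod a) (summand_proj a) _.
Qed.

Lemma cosso_midpoint f g : J (2^-1 *: (f + g)) <= 2^-1 * (J f + J g).
Proof.
rewrite /cosso addrACA [leRHS]mulrDr; apply: lerD.
  rewrite -mulrDr [leRHS]mulrCA ler_wpM2l ?invr_ge0// -big_split mulr_sumr.
  rewrite ler_sum // => i _ /=.
  rewrite evalZ evalD -subr_ge0.
  set u := Defs.eval f (x i); set v := Defs.eval g (x i).
  have : 0 <= (u - v) ^+ 2 by exact: sqr_ge0.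
  nra.
rewrite -mulrDr [leRHS]mulrCA ler_wpM2l ?sqr_ge0// -big_split mulr_sumr.
rewrite ler_sum // => a _ /=.
have sub := summand_submod a; have proj := summand_proj a.
rewrite orth_projZ // orth_projD // normrZ ger0_norm ?invr_ge0//.
by rewrite ler_wpM2l ?invr_ge0// ler_normD.
Qed.

(** The constant component is bounded by writing its value as
[y i - (y i - f (x i)) - h (x i)] for one index [i]: data, residual, and
evaluation of the penalized part [h]. *)
Lemma cosso_coercive : (0 < n)%N -> 0 < tau ->
  forall M, exists B, forall f, J f <= M -> `|f| <= B.
Proof.
move=> n0 tau0 M; pose i := Ordinal n0.
have [[one oneE] _ _ _ _] := dec.
have [K K0 KP] := @eval_bounded _ _ F (x i).
exists ((`|y i| + (n%:R * M + 1) + K * (M / tau ^+ 2)) * `|one| + M / tau ^+ 2).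
move=> f fM; have [c [c0 cE] fE] := orth_proj_sum f.
set h := \sum_a _ in fE.
have hM : `|h| <= M / tau ^+ 2.
  apply: le_trans (ler_norm_sum _ _ _) _.
  rewrite ler_pdivlMr ?exprn_gt0// mulrC.
  by apply: le_trans fM; rewrite lerDr risk_ge0.
have rM : `|y i - Defs.eval f (x i)| <= n%:R * M + 1.
  have : (y i - Defs.eval f (x i)) ^+ 2 <= n%:R * M.
    rewrite -ler_pdivrMl ?ltr0n//.
    apply: le_trans fM; apply: ler_wpDr; first exact: penalty_ge0.
    rewrite ler_wpM2l ?invr_ge0// (bigD1 i) //= lerDl sumr_ge0 // => j _.
    exact: sqr_ge0.
  (* From r ^ 2 <= n M to r <= n M + 1 because r <= r ^ 2 + 1, which avoids a
     square root. *)
  rewrite -real_normK ?num_real//; set r := `|_|.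
  have := sqr_ge0 (r - 1); have : 0 <= r by exact: normr_ge0.
  nra.
have c_one : c = c0 *: one.
  by apply: eval_inj; apply: funext => z; rewrite evalZ oneE cE /= mulr1.
have c0M : `|c0| <= `|y i| + (n%:R * M + 1) + K * (M / tau ^+ 2).
  have -> : c0 = y i - (y i - Defs.eval f (x i)) - Defs.eval h (x i).
    by rewrite fE evalD cE /cst; ring.
  apply: le_trans (ler_normB _ _) _; apply: lerD.
    by apply: le_trans (ler_normB _ _) _; exact: lerD.
  by apply: le_trans (KP h) _; rewrite ler_pM2l.
rewrite fE c_one; apply: le_trans (ler_normD _ _) _; apply: lerD => //.
by rewrite normrZ ler_wpM2r.
Qed.

End objective.

Theorem theorem1 (R : realType) (X : Type) (F : rkhsType R X)
    (p : nat) (Fa : 'I_p -> set F) (n : nat) (x : 'I_n -> X) (y : 'I_n -> R)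
    (tau : R) (hF : orthogonal_decomposition Fa) (hn : (0 < n)%N)
    (htau : 0 < tau) :
  exists fhat : F, forall f : F, cosso Fa x y tau fhat <= cosso Fa x y tau f.
Proof.
apply: midpoint_quasiconvex_attains_min.
- exact: cosso_continuous.
- move=> f g; apply: le_trans (cosso_midpoint hF x y tau f g) _.
  by have [fg|gf] := lerP (cosso Fa x y tau f) (cosso Fa x y tau g); lra.
- by exists 0 => _ [f _ <-]; rewrite addr_ge0 ?risk_ge0 ?penalty_ge0.
- exact: cosso_coercive.
Qed.
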